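(* Let $q\in(1,\infty)$ be fixed and let $\pi_q=\dfrac{2\pi}{q\sin(\pi/q)}$. For each fixed $y\in(0,\pi_q/2]$ the function $p\mapsto\sinh_{p,q}(y)$ is log-convex on $(1,\infty)$.
   Context: For $p,q>1$, $\operatorname{arcsinh}_{p,q}(x)=\int_0^x(1+t^q)^{-1/p}\,dt$ for $x\ge0$, $\hat\pi_{p,q}/2=\int_0^\infty(1+t^q)^{-1/p}\,dt\in(0,\infty]$, and $\sinh_{p,q}:[0,\hat\pi_{p,q}/2)\to[0,\infty)$ is the inverse of $\operatorname{arcsinh}_{p,q}$. For fixed $q$, $\hat\pi_{p,q}$ decreases to $\pi_q$ as $p\downarrow1$, so $\bigcap_{p>1}[0,\hat\pi_{p,q}/2]=[0,\pi_q/2]$ and $\sinh_{p,q}(y)$ is defined for all $p>1$ when $y$ is in this interval. A positive function $f$ on an interval is log-convex if $\log f$ is convex, i.e. $f(\lambda a+(1-\lambda)b)\le f(a)^\lambda f(b)^{1-\lambda}$ for all $a,b$ in the interval and $\lambda\in[0,1]$. *)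

(* Defs.v *)
From HB Require Import structures.
From mathcomp Require Import all_boot all_order all_algebra.
From mathcomp Require Import all_classical all_reals all_analysis.
Import Order.TTheory GRing.Theory Num.Theory.
Import numFieldNormedType.Exports.

Set Implicit Arguments.
Unset Strict Implicit.
Unset Printing Implicit Defensive.

Local Open Scope classical_set_scope.
Local Open Scope ring_scope.

(* Meant for 1 < p, 1 < q and 0 <= x. *)
Definition arcsinhpq (R : realType) (p q x : R) : R :=
  \int[@lebesgue_measure R]_(t in `[0, x]) (1 + t `^ q) `^ (- p^-1).

(* The inverse of [arcsinhpq p q] restricted to [0, +oo[.  The image of this
   restriction is [0, hat pi_{p,q} / 2[ with hat pi_{p,q} / 2 the integral of the
   same integrand over [0, +oo[; outside it the inverse is set to 0, so
   [0 < sinhpq p q y] holds only for y in the domain of sinh_{p,q}. *)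
Definition sinhpq (R : realType) (p q : R) : R -> R :=
  'pinv_(fun=> 0) `[0, +oo[ (arcsinhpq p q).

Definition piq (R : realType) (q : R) : R := 2 * pi / (q * sin (pi / q)).

Definition log_convex (R : realType) (D : set R) (f : R -> R) : Prop :=
  (forall x, D x -> 0 < f x) /\ @convex_function R R^o D (fun x => ln (f x)).

(* Main.v *)
Require Import Defs.
From HB Require Import structures.
From mathcomp Require Import all_boot all_order all_algebra.
From mathcomp Require Import all_classical all_reals all_analysis.
From mathcomp Require Import ring lra measurable_realfun.
Set Implicit Arguments.
Unset Strict Implicit.
Unset Printing Implicit Defensive.
Import Order.TTheory GRing.Theory Num.Theory.
Import numFieldNormedType.Exports.
Local Open Scope classical_set_scope.
Local Open Scope ring_scope.

(** Write [A_p] for [arcsinhpq p q], [x_p] for its inverse [sinhpq p q].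

    Log-convexity. Let [p = l p1 + m p2] with [p1 <= p2], [l + m = 1], and let
    [X(s) = x_p1(s)^l x_p2(s)^m]. It suffices that [s <= A_p(X(s))], for then
    [x_p(s) <= X(s)]. Both sides tend to [0] at [0], so it suffices that
    [A_p(X(s))] has derivative at least [1]. As [x_p' = (1 + x_p^q)^(1/p)],
    this says
      [l (1+x1^q)^(1/p1) / x1 + m (1+x2^q)^(1/p2) / x2 >= (1+X^q)^(1/p) / X]
    where [x1 = x_p1(s)], [x2 = x_p2(s)]. By the weighted inequality of the means, it is
    enough to compare logarithms, where [- ln x] contributes the same to both
    sides. With [L(x) = ln (1 + x^q)], convex in [ln x], there remains
      [(l L(x1) + m L(x2)) / p <= l L(x1) / p1 + m L(x2) / p2],
    which is Chebyshev's inequality for [L(x1), L(x2)] and [1 / p1, 1 / p2],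
    together with the convexity of the inverse: they are ordered alike because
    [A_p] increases with [p], whence [x1 >= x2]. The function
    [L / p] is not jointly convex in [(p, ln x)]; this common ordering is what
    replaces joint convexity ([density_geo_le], [le_arcsinhpq_geo]).

    Domain. One also needs [pi_q / 2 < sup A_p] for every [p > 1]. Since
    [A_p - A_1] is increasing and positive at [1], it suffices that
    [sup A_1 >= pi_q / 2] ([arcsinh1q_gt]). Expanding [1 / (1 + t^q)] into an
    even number of terms of the geometric series in [t^q] on the unit interval, and
    in [t^-q] beyond it, gives lower bounds for the integrand, and after
    integration the partial sums of
      [(1/q) sum_n (-1)^n (1 / (n + a) + 1 / (n + 1 - a))] for [a = 1/q].
    The sum of this series is [(pi / q) / sin (pi a)]: see
    [cosecant_partial_sum], which bounds the partial sums from below through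
    the derivative of [sinc_sum], a modulated Dirichlet kernel. *)

(** * Derivatives of functions in explicit form *)

Lemma is_derive_const (R : realType) (c x : R) :
  is_derive x 1 (fun=> c : R) (0 : R).
Proof. exact: is_derive_cst. Qed.

Lemma is_derive_var (R : realType) (x : R) :
  is_derive x 1 (fun t : R => t) (1 : R).
Proof. exact: is_derive_id. Qed.

Lemma is_derive_add (R : realType) (f g : R -> R) (x a b : R) :
  is_derive x 1 f a -> is_derive x 1 g b ->
  is_derive x 1 (fun t => f t + g t) (a + b).
Proof. by move=> ? ?; exact: is_deriveD. Qed.

Lemma is_derive_sub (R : realType) (f g : R -> R) (x a b : R) :
  is_derive x 1 f a -> is_derive x 1 g b ->
  is_derive x 1 (fun t => f t - g t) (a - b).
Proof. by move=> ? ?; exact: is_deriveB. Qed.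

Lemma is_derive_mul (R : realType) (f g : R -> R) (x a b : R) :
  is_derive x 1 f a -> is_derive x 1 g b ->
  is_derive x 1 (fun t => f t * g t) (a * g x + f x * b).
Proof.
move=> fa gb; apply: is_derive_eq.
by rewrite addrC /GRing.scale /= [g x * _]mulrC.
Qed.

Lemma is_derive_mulr_const (R : realType) (c x : R) :
  is_derive x 1 (fun t : R => c * t) c.
Proof.
have := is_derive_mul (is_derive_cst c x 1) (is_derive_id x 1).
by rewrite mul0r add0r mulr1.
Qed.

Lemma is_derive_comp (R : realType) (f g : R -> R) (x a b : R) :
  is_derive (g x) 1 f a -> is_derive x 1 g b ->
  is_derive x 1 (fun t => f (g t)) (a * b).
Proof. by move=> fa gb; apply: is_derive_eq; rewrite mulrC. Qed.

Lemma is_derive_inv (R : realType) (f : R -> R) (x a : R) :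
  f x != 0 -> is_derive x 1 f a ->
  is_derive x 1 (fun t => (f t)^-1) (- (a / (f x) ^+ 2)).
Proof.
move=> fx0 fa; have d := is_deriveV fx0 fa.
by apply: (is_derive_eq d); rewrite /GRing.scale/= mulrC mulrN.
Qed.

Lemma is_derive_powR_comp (R : realType) (r : R) (g : R -> R) (x b : R) :
  0 < g x -> is_derive x 1 g b ->
  is_derive x 1 (fun t => g t `^ r) (r * g x `^ (r - 1) * b).
Proof. by move=> g0 gb; exact: is_derive_comp (is_derive1_powR r g0) gb. Qed.

Lemma is_derive_sum_nat (R : realType) (F : nat -> R -> R) (a : nat -> R)
    (N : nat) (x : R) :
  (forall n, is_derive x 1 (F n) (a n)) ->
  is_derive x 1 (fun t => \sum_(n < N) F n t) (\sum_(n < N) a n).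
Proof.
move=> Fa; elim: N => [|N IH].
  rewrite big_ord0; have := is_derive_cst (0 : R) x 1.
  by congr is_derive; apply/funext => t; rewrite big_ord0.
rewrite big_ord_recr/=; have := is_derive_add IH (Fa N).
by congr is_derive; apply/funext => t; rewrite big_ord_recr.
Qed.

Lemma is_derive_continuous (R : realType) (f : R -> R) (x a : R) :
  is_derive x 1 f a -> {for x, continuous f}.
Proof.
by move=> [fx _]; apply: differentiable_continuous; apply/derivable1_diffP.
Qed.

Lemma mean_value_is_derive (R : realType) (f f' : R -> R) (a b : R) :
  a < b -> (forall x, a <= x <= b -> is_derive x 1 f (f' x)) ->
  exists2 c, a < c < b & f b - f a = f' c * (b - a).
Proof.
move=> ab df.
have cf : {within `[a, b], continuous f}.
  apply: continuous_in_subspaceT => x; rewrite inE/= in_itv/= => xab.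
  exact: (is_derive_continuous (df x xab)).
have df' x : x \in `]a, b[ -> is_derive x 1 f (f' x).
  by rewrite in_itv/= => /andP[ax xb]; apply: df; rewrite !ltW.
have [c + E] := MVT ab df' cf.
by rewrite in_itv/= => cab; exists c.
Qed.

Lemma le_of_is_derive_ge0 (R : realType) (f f' : R -> R) (a b : R) :
  a < b -> (forall x, a <= x <= b -> is_derive x 1 f (f' x)) ->
  (forall x, a < x < b -> 0 <= f' x) -> f a <= f b.
Proof.
move=> ab df f'0; have [c cab E] := mean_value_is_derive ab df.
by rewrite -subr_ge0 E mulr_ge0 ?f'0// subr_ge0 ltW.
Qed.

Lemma lt_of_is_derive_gt0 (R : realType) (f f' : R -> R) (a b : R) :
  a < b -> (forall x, a <= x <= b -> is_derive x 1 f (f' x)) ->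
  (forall x, a < x < b -> 0 < f' x) -> f a < f b.
Proof.
move=> ab df f'0; have [c cab E] := mean_value_is_derive ab df.
by rewrite -subr_gt0 E mulr_gt0 ?f'0// subr_gt0.
Qed.

(** The linear lower bound replaces continuity at [0], where the functions below
    are powers or quotients whose derivative is only available for [x > 0]. *)
Lemma ge0_of_is_derive_ge0 (R : realType) (f f' : R -> R) (b C : R) :
  0 < b -> (forall x, 0 < x <= b -> is_derive x 1 f (f' x)) ->
  (forall x, 0 < x < b -> 0 <= f' x) ->
  (forall x, 0 < x < b -> - (C * x) <= f x) -> 0 <= f b.
Proof.
move=> b0 df f'0 fC; rewrite leNgt; apply/negP => fb.
pose d := `|C| + 1.
have d0 : 0 < d by rewrite /d ltr_wpDl.
pose e := Num.min (b / 2) (- f b / (2 * d)).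
have e0 : 0 < e.
  by rewrite lt_min !divr_gt0// ?oppr_gt0// mulr_gt0.
have eb : e < b by rewrite gt_min; apply/orP; left; lra.
have : f e <= f b.
  apply: (le_of_is_derive_ge0 eb (f' := f')) => x /andP[ex xb].
    by apply: df; rewrite xb (lt_le_trans e0 ex).
  by apply: f'0; rewrite xb (lt_trans e0 ex).
have := fC e; rewrite e0 eb => /(_ isT).
have Ce : C * e <= d * e.
  by rewrite ler_pM2r// /d; have := ler_norm C; lra.
have : d * e <= - f b / 2.
  have : e <= - f b / (2 * d) by rewrite ge_min lexx orbT.
  rewrite ler_pdivlMr ?mulr_gt0//; nra.
lra.
Qed.

(** * The integral and its inverse *)

Definition density (R : realType) (p q t : R) : R := (1 + t `^ q) `^ (- p^-1).

Lemma one_add_powR_ge1 (R : realType) (q t : R) : 1 <= 1 + t `^ q.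
Proof. by rewrite lerDl powR_ge0. Qed.

Lemma one_add_powR_gt0 (R : realType) (q t : R) : 0 < 1 + t `^ q.
Proof. exact: lt_le_trans (one_add_powR_ge1 q t). Qed.
#[local] Hint Resolve one_add_powR_ge1 one_add_powR_gt0 : core.

Lemma density_gt0 (R : realType) (p q t : R) : 0 < density p q t.
Proof. exact: powR_gt0. Qed.

Lemma density_le1 (R : realType) (p q t : R) : 0 < p -> density p q t <= 1.
Proof.
move=> p0; rewrite -[leRHS](@powRr0 _ (1 + t `^ q)) ler_powR//.
by rewrite oppr_le0 invr_ge0 ltW.
Qed.

Lemma density_1 (R : realType) (q t : R) : density 1 q t = (1 + t `^ q)^-1.
Proof. by rewrite /density invr1 powR_inv1// ltW. Qed.

Lemma le_density (R : realType) (p1 p2 q t : R) :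
  0 < p1 -> p1 <= p2 -> density p1 q t <= density p2 q t.
Proof.
move=> p10 p12; rewrite /density ler_powR// lerN2 lef_pV2// posrE//.
exact: lt_le_trans p12.
Qed.

Lemma lt_density (R : realType) (p1 p2 q t : R) :
  0 < p1 -> p1 < p2 -> 0 < t -> density p1 q t < density p2 q t.
Proof.
move=> p10 p12 t0; rewrite /density /powR !gt_eqF// ltr_expR.
have L0 : 0 < ln (1 + expR (q * ln t)) by rewrite ln_gt0// ltrDl expR_gt0.
rewrite ltr_pM2r//.
by rewrite ltrN2 ltf_pV2// posrE (lt_trans p10).
Qed.

Lemma density_continuous (R : realType) (p q x : R) :
  0 < x -> {for x, continuous (density p q)}.
Proof.
move=> x0.
have dx : is_derive x 1 (fun t => 1 + t `^ q) (0 + q * x `^ (q - 1)).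
  exact: is_derive_add (is_derive_const 1 x) (is_derive1_powR q x0).
have := @is_derive_powR_comp R (- p^-1) (fun t => 1 + t `^ q) x _
  (one_add_powR_gt0 q x) dx.
exact: is_derive_continuous.
Qed.

Lemma density_integrable (R : realType) (p q a b : R) : 0 < p ->
  (@lebesgue_measure R).-integrable `[a, b] (EFin \o density p q).
Proof.
move=> p0; apply: measurable_bounded_integrable => //.
- rewrite /= lebesgue_measure_itv/=; case: ifP => _; last by rewrite ltry.
  by rewrite -EFinB ltry.
- apply: (measurableT_comp (measurable_powR _)) => //.
  apply: measurable_funD => //.
  exact: (measurable_funS measurableT).
- exists 1; split => // M M1 t _ /=.
  rewrite ger0_norm ?(ltW (density_gt0 _ _ _))//.
  exact: le_trans (density_le1 _ _ p0) (ltW M1).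
Qed.

Lemma arcsinhpqE (R : realType) (p q x : R) :
  arcsinhpq p q x = \int[@lebesgue_measure R]_(t in `[0, x]) density p q t.
Proof. by []. Qed.

(** Restricted to [0 < x] because [t `^ q] jumps at [0]: it is [1] for [t < 0]. *)
Lemma is_derive_arcsinhpq (R : realType) (p q x : R) : 0 < p -> 0 < x ->
  is_derive x 1 (arcsinhpq p q) (density p q x).
Proof.
move=> p0 x0; have xu : x < x + 1 by rewrite ltrDl.
have [dx Ex] := continuous_FTC1_closed xu (density_integrable q 0 (x + 1) p0)
  x0 (density_continuous (p := p) (q := q) x0).
by split; [exact: dx|rewrite -derive1E].
Qed.

Lemma arcsinhpq0 (R : realType) (p q : R) : arcsinhpq p q 0 = 0.
Proof. by rewrite /arcsinhpq set_itv1 Rintegral_set1. Qed.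

Lemma arcsinhpq_continuous (R : realType) (p q b : R) : 0 < p -> 0 <= b ->
  {within `[0, b], continuous (arcsinhpq p q)}.
Proof.
move=> p0 b0.
exact: (parameterized_integral_continuous b0 (density_integrable q 0 b p0)).
Qed.

Lemma arcsinhpq_lt (R : realType) (p q x z : R) : 0 < p -> 0 <= x -> x < z ->
  arcsinhpq p q x < arcsinhpq p q z.
Proof.
move=> p0 x0 xz; have z0 : 0 <= z by rewrite ltW// (le_lt_trans x0).
apply: (@gtr0_derive1_lt_cc _ (arcsinhpq p q) 0 z) => //.
- by move=> t; rewrite in_itv/= => /andP[t0 _];
  have [] := is_derive_arcsinhpq q p0 t0.
- move=> t; rewrite in_itv/= => /andP[t0 _].
  have [_] := is_derive_arcsinhpq q p0 t0.
  by rewrite derive1E => ->; exact: density_gt0.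
- exact: arcsinhpq_continuous.
- by rewrite in_itv/= x0 ltW.
- by rewrite in_itv/= lexx z0.
Qed.

Lemma arcsinhpq_inj (R : realType) (p q : R) : 0 < p ->
  {in `[0, +oo[ &, injective (arcsinhpq p q)}.
Proof.
move=> p0 x z; rewrite !in_itv/= !andbT => x0 z0 E.
have [xz|zx|//] := ltgtP x z.
- by have := arcsinhpq_lt q p0 x0 xz; rewrite E ltxx.
- by have := arcsinhpq_lt q p0 z0 zx; rewrite E ltxx.
Qed.

Lemma arcsinhpq_le_p (R : realType) (p1 p2 q x : R) : 0 < p1 -> p1 <= p2 ->
  arcsinhpq p1 q x <= arcsinhpq p2 q x.
Proof.
move=> p10 p12; rewrite !arcsinhpqE le_Rintegral//.
- exact: density_integrable.
- by apply: density_integrable; exact: lt_le_trans p12.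
- by move=> t _; exact: le_density.
Qed.

Lemma arcsinhpqK (R : realType) (p q x : R) : 0 < p -> 0 <= x ->
  sinhpq p q (arcsinhpq p q x) = x.
Proof.
move=> p0 x0; apply: pinvKV; last by rewrite inE/= in_itv/= x0.
by move=> z w; rewrite !inE; exact: arcsinhpq_inj.
Qed.

Lemma sinhpq_spec (R : realType) (p q b s : R) : 0 < p -> 0 <= b ->
  0 < s <= arcsinhpq p q b ->
  0 < sinhpq p q s /\ arcsinhpq p q (sinhpq p q s) = s.
Proof.
move=> p0 b0 /andP[s0 sb].
have [|z + Es] := @IVT R (arcsinhpq p q) 0 b s b0
  (@arcsinhpq_continuous R p q b p0 b0).
  by rewrite arcsinhpq0 ge_min ltW//= le_max sb orbT.
rewrite in_itv/= => /andP[z0 _].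
rewrite -Es arcsinhpqK//; split => //.
rewrite lt_neqAle z0 andbT; apply/eqP => zE.
by move: s0; rewrite -Es -zE arcsinhpq0 ltxx.
Qed.

(* Kept folded so that matching derivatives or inequalities of these functions
   does not unfold the integral or the partial inverse. *)
#[local] Opaque arcsinhpq sinhpq.

Lemma is_derive_sinhpq (R : realType) (p q x : R) : 0 < p -> 0 < x ->
  is_derive (arcsinhpq p q x) 1 (sinhpq p q) (density p q x)^-1.
Proof.
move=> p0 x0; apply: is_derive_inverse.
- near=> z; apply: arcsinhpqK => //; apply: ltW.
  by near: z; exact: lt_nbhsr.
- near=> z; apply: (is_derive_continuous (a := density p q z)).
  apply: is_derive_arcsinhpq => //.
  by near: z; exact: lt_nbhsr.
- exact: is_derive_arcsinhpq.
- by rewrite gt_eqF// density_gt0.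
Unshelve. all: by end_near. Qed.

(** * A differential inequality for weighted geometric means *)

Lemma le_weighted_ln (R : realType) (l m a b : R) :
  0 <= l -> 0 <= m -> l + m = 1 -> 0 < a -> 0 < b ->
  l * ln a + m * ln b <= ln (l * a + m * b).
Proof.
move=> l0 m0 lm a0 b0; have l1 : l <= 1 by rewrite -lm lerDl.
have -> : m = 1 - l by rewrite -lm addrC addKr.
exact: (concave_ln (Itv01 l0 l1) a0 b0).
Qed.

Lemma le_weighted_geo (R : realType) (l m a b : R) :
  0 <= l -> 0 <= m -> l + m = 1 -> 0 < a -> 0 < b ->
  expR (l * ln a + m * ln b) <= l * a + m * b.
Proof.
move=> l0 m0 lm a0 b0; rewrite -[leRHS]lnK; last first.
  rewrite posrE; have [lz|l1] := eqVneq l 0.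
    by move: lm; rewrite lz add0r => ->; rewrite mul0r add0r mul1r.
  by rewrite ltr_wpDr ?mulr_ge0 ?mulr_gt0 ?(ltW b0)// lt0r l1.
by rewrite ler_expR le_weighted_ln.
Qed.

(** Convexity of [u |-> ln (1 + e^u)], in its multiplicative form the Hoelder
    inequality for the pairs [(1, e^u)] and [(1, e^v)]: divide by the right-hand
    side and add the inequality of the means for [1 / (1 + e^u), 1 / (1 + e^v)]
    to the one for their complements to [1]. *)
Lemma ln_one_add_geo (R : realType) (l m u v : R) :
  0 <= l -> 0 <= m -> l + m = 1 ->
  ln (1 + expR (l * u + m * v)) <=
  l * ln (1 + expR u) + m * ln (1 + expR v).
Proof.
move=> l0 m0 lm.
have P (w : R) : 0 < 1 + expR w by rewrite addr_gt0// expR_gt0.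
pose s := l * ln (1 + expR u) + m * ln (1 + expR v).
have H1 := le_weighted_geo l0 m0 lm (a := (1 + expR u)^-1) (b := (1 + expR v)^-1).
have H2 := le_weighted_geo l0 m0 lm
  (a := expR u / (1 + expR u)) (b := expR v / (1 + expR v)).
move: H1 H2; rewrite !invr_gt0 !divr_gt0 ?expR_gt0 ?P// => /(_ isT isT) H1.
move=> /(_ isT isT); rewrite !lnM ?posrE ?invr_gt0 ?expR_gt0 ?P//.
rewrite !expRK !lnV ?posrE ?P// => H2.
move: H1; rewrite !lnV ?posrE ?P// => H1.
have E1 : expR (l * - ln (1 + expR u) + m * - ln (1 + expR v)) = expR (- s).
  by congr expR; rewrite /s; ring.
have E2 : expR (l * (u - ln (1 + expR u)) + m * (v - ln (1 + expR v)))
    = expR (l * u + m * v) * expR (- s).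
  by rewrite -expRD; congr expR; rewrite /s; ring.
rewrite E1 in H1; rewrite E2 in H2.
rewrite -ler_expR lnK ?posrE ?P// -/s -[leRHS]mul1r -ler_pdivrMr ?expR_gt0//.
rewrite -expRN mulrDl mul1r (le_trans (lerD H1 H2))//.
have := P u; have := P v; move: (expR u) (expR v) => a b b0 a0.
suff -> : l * (1 + a)^-1 + m * (1 + b)^-1 + (l * (a / (1 + a)) + m * (b / (1 + b)))
  = l + m by rewrite lm.
by field; rewrite !gt_eqF.
Qed.

(** The difference of the two sides is
    [l m (p2 - p1) / (l p1 + m p2) * (L1 / p1 - L2 / p2)]. *)
Lemma chebyshev_weighted (R : realType) (l m p1 p2 L1 L2 : R) :
  0 <= l -> 0 <= m -> l + m = 1 -> 0 < p1 -> p1 <= p2 -> 0 <= L2 -> L2 <= L1 ->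
  (l * L1 + m * L2) / (l * p1 + m * p2) <= l * (L1 / p1) + m * (L2 / p2).
Proof.
move=> l0 m0 lm p10 p12 L20 L12.
have p20 : 0 < p2 by exact: lt_le_trans p12.
have p0 : 0 < l * p1 + m * p2.
  by have : p1 <= l * p1 + m * p2; [nra|exact: lt_le_trans].
rewrite -subr_ge0.
have -> : l * (L1 / p1) + m * (L2 / p2) - (l * L1 + m * L2) / (l * p1 + m * p2)
  = l * m * (p2 - p1) / (l * p1 + m * p2) * (L1 / p1 - L2 / p2).
  have -> : m = 1 - l by rewrite -lm addrC addKr.
  have ml : m = 1 - l by rewrite -lm addrC addKr.
  by field; rewrite -ml !gt_eqF.
apply: mulr_ge0.
  by rewrite divr_ge0 ?mulr_ge0 ?subr_ge0// ltW.
by rewrite subr_ge0 ler_pM ?invr_ge0 ?(ltW p20)// lef_pV2.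
Qed.

Lemma ln_density (R : realType) (p q x : R) :
  ln (density p q x) = - (ln (1 + x `^ q) / p).
Proof. by rewrite /density ln_powR mulNr mulrC. Qed.

(** When [x1 = sinhpq p1 q s], the derivative of [ln x1] in [s] is
    [(density p1 q x1 * x1)^-1], and likewise for [x2]; the right-hand side is then
    the derivative in [s] of [arcsinhpq (l * p1 + m * p2) q X]. *)
Lemma density_geo_le (R : realType) (l m p1 p2 q x1 x2 X : R) :
  0 <= l -> 0 <= m -> l + m = 1 -> 0 < p1 -> p1 <= p2 -> 0 < q ->
  0 < x2 -> x2 <= x1 ->
  X = expR (l * ln x1 + m * ln x2) ->
  1 <= density (l * p1 + m * p2) q X * X *
    (l * (density p1 q x1 * x1)^-1 + m * (density p2 q x2 * x2)^-1).
Proof.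
move=> l0 m0 lm p10 p12 q0 x20 x21 XE.
have x10 : 0 < x1 by exact: lt_le_trans x21.
have p0 : 0 < l * p1 + m * p2.
  by have : p1 <= l * p1 + m * p2; [nra|exact: lt_le_trans].
have X0 : 0 < X by rewrite XE expR_gt0.
have D0 : 0 < density (l * p1 + m * p2) q X * X.
  by rewrite mulr_gt0// density_gt0.
rewrite mulrC -ler_pdivrMr// mul1r.
have d1 : 0 < density p1 q x1 * x1 by rewrite mulr_gt0// density_gt0.
have d2 : 0 < density p2 q x2 * x2 by rewrite mulr_gt0// density_gt0.
have Di1 := d1; have Di2 := d2; rewrite -invr_gt0 in Di1; rewrite -invr_gt0 in Di2.
apply: le_trans (le_weighted_geo l0 m0 lm Di1 Di2).
rewrite -[leLHS]lnK ?posrE ?invr_gt0// ler_expR.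
have lnE p x : 0 < x -> ln (density p q x * x)^-1 =
    ln (1 + expR (q * ln x)) / p - ln x.
  move=> x0; have dx0 := density_gt0 p q x.
  rewrite lnV; last by rewrite posrE mulr_gt0.
  rewrite (lnM dx0 x0) ln_density {1}/powR (gt_eqF x0) opprD opprK.
  by [].
rewrite !lnE// {X0 D0 d1 d2 Di1 Di2} XE expRK.
pose L1 := ln (1 + expR (q * ln x1)); pose L2 := ln (1 + expR (q * ln x2)).
rewrite -/L1 -/L2.
have L20 : 0 <= L2 by rewrite ln_ge0// lerDl expR_ge0.
have L12 : L2 <= L1.
  rewrite /L1 /L2 ler_ln ?posrE ?addr_gt0 ?expR_gt0// lerD2l ler_expR.
  by rewrite ler_pM2l// ler_ln.
have := chebyshev_weighted l0 m0 lm p10 p12 L20 L12.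
have := ln_one_add_geo (q * ln x1) (q * ln x2) l0 m0 lm.
rewrite -/L1 -/L2 (_ : l * (q * _) + _ = q * (l * ln x1 + m * ln x2)); last by ring.
move=> H C; have H' : ln (1 + expR (q * (l * ln x1 + m * ln x2))) / (l * p1 + m * p2)
  <= (l * L1 + m * L2) / (l * p1 + m * p2) by rewrite ler_pM2r ?invr_gt0.
rewrite lerBlDr (le_trans (le_trans H' C))//.
rewrite le_eqVlt; apply/orP; left; apply/eqP; ring.
Qed.

(** The bounds [b1] and [b2] express that [y] lies in the ranges of
    [arcsinhpq p1 q] and [arcsinhpq p2 q]. *)
Lemma le_arcsinhpq_geo (R : realType) (l m p1 p2 q y b1 b2 : R) :
  0 <= l -> 0 <= m -> l + m = 1 -> 0 < p1 -> p1 <= p2 -> 0 < q ->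
  0 < y -> 0 <= b1 -> 0 <= b2 -> y <= arcsinhpq p1 q b1 -> y <= arcsinhpq p2 q b2 ->
  y <= arcsinhpq (l * p1 + m * p2) q
         (expR (l * ln (sinhpq p1 q y) + m * ln (sinhpq p2 q y))).
Proof.
move=> l0 m0 lm p10 p12 q0 y0 b10 b20 yb1 yb2.
have p20 : 0 < p2 by exact: lt_le_trans p12.
have p0 : 0 < l * p1 + m * p2.
  by have : p1 <= l * p1 + m * p2; [nra|exact: lt_le_trans].
set p := l * p1 + m * p2 in p0 *.
pose X s := expR (l * ln (sinhpq p1 q s) + m * ln (sinhpq p2 q s)).
pose X' s := X s * (l * (density p1 q (sinhpq p1 q s) * sinhpq p1 q s)^-1
  + m * (density p2 q (sinhpq p2 q s) * sinhpq p2 q s)^-1).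
rewrite -/(X y) -subr_ge0.
apply: (@ge0_of_is_derive_ge0 R (fun s => arcsinhpq p q (X s) - s)
  (fun s => density p q (X s) * X' s - 1) y 1) => //.
- move=> s /andP[s0 sy].
  apply: (is_derive_sub _ (is_derive_var s)).
  apply: (@is_derive_comp R (arcsinhpq p q) X s).
    exact: is_derive_arcsinhpq (expR_gt0 _).
  have sb1 : 0 < s <= arcsinhpq p1 q b1 by rewrite s0 (le_trans sy).
  have sb2 : 0 < s <= arcsinhpq p2 q b2 by rewrite s0 (le_trans sy).
  have [x10 E1] := sinhpq_spec p10 b10 sb1.
  have [x20 E2] := sinhpq_spec p20 b20 sb2.
  have d1 := is_derive_sinhpq q p10 x10; rewrite E1 in d1.
  have d2 := is_derive_sinhpq q p20 x20; rewrite E2 in d2.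
  have e1 := is_derive_mul (is_derive_const l s)
    (is_derive_comp (is_derive1_ln x10) d1).
  have e2 := is_derive_mul (is_derive_const m s)
    (is_derive_comp (is_derive1_ln x20) d2).
  have dX := is_derive_comp (is_derive_expR _) (is_derive_add e1 e2).
  apply: (is_derive_eq dX); rewrite /X' /X.
  have aux (e u v a1 c1 a2 c2 : R) :
      e * (0 * u + l * (c1^-1 * a1^-1) + (0 * v + m * (c2^-1 * a2^-1)))
      = e * (l * (a1 * c1)^-1 + m * (a2 * c2)^-1).
    by rewrite !mul0r !add0r !invfM [c1^-1 * _]mulrC [c2^-1 * _]mulrC.
  exact: aux.
- move=> s /andP[s0 sy].
  have sb1 : 0 < s <= arcsinhpq p1 q b1 by rewrite s0 (le_trans (ltW sy)).
  have sb2 : 0 < s <= arcsinhpq p2 q b2 by rewrite s0 (le_trans (ltW sy)).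
  have [x10 E1] := sinhpq_spec p10 b10 sb1.
  have [x20 E2] := sinhpq_spec p20 b20 sb2.
  have x21 : sinhpq p2 q s <= sinhpq p1 q s.
    rewrite leNgt; apply/negP => x12.
    have := arcsinhpq_lt q p20 (ltW x10) x12; rewrite E2.
    have := arcsinhpq_le_p q (sinhpq p1 q s) p10 p12; rewrite E1.
    by move=> /le_lt_trans/[apply]; rewrite ltxx.
  rewrite subr_ge0 mulrA.
  exact: density_geo_le.
- move=> s /andP[s0 _]; rewrite mul1r addrC lerDl.
  by have := arcsinhpq_lt q p0 (lexx 0) (expR_gt0 _ : 0 < X s);
    rewrite arcsinhpq0; exact: ltW.
Qed.

(** * Partial sums of the expansion of the cosecant into simple fractions *)

(** The primitive of [t |-> cos (c t)] that vanishes at [0]; including [c = 0]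
    allows the comparison of [sinc_sum a] with [sinc_sum 0]. *)
Definition sinc (R : realType) (c t : R) : R :=
  if c == 0 then t else sin (c * t) / c.

Lemma is_derive_sinM (R : realType) (c t : R) :
  is_derive t 1 (fun s : R => sin (c * s)) (c * cos (c * t)).
Proof.
rewrite mulrC.
exact: is_derive_comp (is_derive_sin _) (is_derive_mulr_const c t).
Qed.

Lemma is_derive_cosM (R : realType) (c t : R) :
  is_derive t 1 (fun s : R => cos (c * s)) (- (c * sin (c * t))).
Proof.
rewrite mulrC -mulNr.
exact: is_derive_comp (is_derive_cos _) (is_derive_mulr_const c t).
Qed.

Lemma is_derive_sinc (R : realType) (c t : R) :
  is_derive t 1 (sinc c) (cos (c * t)).
Proof.
rewrite /sinc; have [->|c0] := eqVneq c 0.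
  by rewrite mul0r cos0; exact: is_derive_var.
have := is_derive_mul (is_derive_sinM c t) (is_derive_const c^-1 t).
by rewrite mulr0 addr0 mulrAC divff// mul1r.
Qed.

Lemma sinc0 (R : realType) (c : R) : sinc c 0 = 0.
Proof. by rewrite /sinc; case: ifP => // _; rewrite mulr0 sin0 mul0r. Qed.

Lemma sinc_le (R : realType) (c t : R) : 0 < t -> - t <= sinc c t <= t.
Proof.
move=> t0; apply/andP; split.
- rewrite -subr_ge0 opprK.
  have := @le_of_is_derive_ge0 R (fun s => sinc c s + s)
    (fun s => cos (c * s) + 1) 0 t t0.
  rewrite sinc0 addr0; apply.
  + by move=> s _; apply: (is_derive_add _ (is_derive_var s)); exact: is_derive_sinc.
  + by move=> s _; rewrite -lerBlDr sub0r cos_geN1.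
- rewrite -subr_ge0.
  have := @le_of_is_derive_ge0 R (fun s => s - sinc c s)
    (fun s => 1 - cos (c * s)) 0 t t0.
  rewrite sinc0 subr0; apply.
  + by move=> s _; apply: (is_derive_sub (is_derive_var s)); exact: is_derive_sinc.
  + by move=> s _; rewrite subr_ge0 cos_le1.
Qed.

Definition sinc_sum (R : realType) (a : R) (N : nat) (t : R) : R :=
  \sum_(n < N) (sinc (n%:R + a) t + sinc (n%:R + 1 - a) t).

Definition cos_sum (R : realType) (a : R) (N : nat) (t : R) : R :=
  \sum_(n < N) (cos ((n%:R + a) * t) + cos ((n%:R + 1 - a) * t)).

Lemma is_derive_sinc_sum (R : realType) (a : R) (N : nat) (t : R) :
  is_derive t 1 (sinc_sum a N) (cos_sum a N t).
Proof.
apply: (@is_derive_sum_nat R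
  (fun n t => sinc (n%:R + a) t + sinc (n%:R + 1 - a) t)
  (fun n => cos ((n%:R + a) * t) + cos ((n%:R + 1 - a) * t))) => n.
by apply: is_derive_add; exact: is_derive_sinc.
Qed.

Lemma sinc_sum_le (R : realType) (a : R) (N : nat) (t : R) : 0 < t ->
  - (N%:R * (2 * t)) <= sinc_sum a N t <= N%:R * (2 * t).
Proof.
move=> t0; elim: N => [|N]; first by rewrite /sinc_sum big_ord0 mul0r oppr0 lexx.
rewrite /sinc_sum big_ord_recr/= -/(sinc_sum a N t) -natr1 => /andP[IH1 IH2].
have /andP[b1 b2] := sinc_le (N%:R + a) t0.
have /andP[c1 c2] := sinc_le (N%:R + 1 - a) t0.
by rewrite mulrDl mul1r; apply/andP; split; lra.
Qed.

(** The terms of index [n] add up to [2 cos ((a - 1/2) t) cos ((n + 1/2) t)], and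
    multiplication by [sin (t / 2)] makes the second factors telescope. *)
Lemma cos_sumE (R : realType) (a : R) (N : nat) (t : R) :
  cos_sum a N t * sin (t / 2) = cos ((a - 2^-1) * t) * sin (N%:R * t).
Proof.
elim: N => [|N]; first by rewrite /cos_sum big_ord0 mul0r mul0r sin0 mulr0.
rewrite /cos_sum big_ord_recr/= -/(cos_sum a N t) => IH; rewrite [LHS]mulrDl IH.
pose A := (N%:R + 2^-1) * t; pose B := (a - 2^-1) * t.
have -> : (N%:R + a) * t = A + B by rewrite /A /B; ring.
have -> : (N%:R + 1 - a) * t = A - B by rewrite /A /B; field.
have -> : N%:R * t = A - t / 2 by rewrite /A; field.
have -> : N.+1%:R * t = A + t / 2 by rewrite /A -natr1; field.
by rewrite -/B (cosD A B) (cosB A B) (sinD A (t / 2)) (sinB A (t / 2)); ring.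
Qed.

Lemma sinc_sum_pi (R : realType) (a : R) (N : nat) : 0 < a < 1 ->
  sinc_sum a N pi = sin (pi * a) *
    \sum_(n < N) (-1) ^+ n * ((n%:R + a)^-1 + (n%:R + 1 - a)^-1).
Proof.
move=> /andP[a0 a1]; rewrite /sinc_sum big_distrr/=; apply: eq_bigr => n _.
have n0 : 0 <= n%:R :> R by [].
have na : 0 < n%:R + a by lra.
have nb : 0 < n%:R + 1 - a by lra.
rewrite /sinc (gt_eqF na) (gt_eqF nb).
have -> : sin ((n%:R + a) * pi) = (-1) ^+ n * sin (pi * a).
  rewrite -(alternatingn (@sinDpi R)); congr sin.
  by rewrite -mulr_natr; ring.
have -> : sin ((n%:R + 1 - a) * pi) = (-1) ^+ n * sin (pi * a).
  rewrite -[in RHS](opprK (sin (pi * a))) -sinN -sinDpi.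
  rewrite -(alternatingn (@sinDpi R)); congr sin.
  by rewrite -mulr_natr; ring.
by ring.
Qed.

(** At [a = 0] all terms vanish at [pi] but the one of frequency [0], which gives
    the constant in the limit. *)
Lemma sinc_sum0_pi (R : realType) (N : nat) : sinc_sum 0 N.+1 pi = pi :> R.
Proof.
have s0 (n : nat) : sinc (n%:R + 1) pi = 0 :> R.
  rewrite /sinc gt_eqF ?ltr_wpDl// natr1 mulr_natl -[pi *+ _]add0r.
  by rewrite (alternatingn (@sinDpi R)) sin0 mulr0 mul0r.
rewrite /sinc_sum big_ord_recl big1 => [|n _].
  by rewrite subr0 s0 !addr0 /sinc eqxx.
by rewrite addr0 subr0 lift0 s0 -natr1 s0 addr0.
Qed.

Lemma sinM_bounds (R : realType) (b t : R) : 0 <= b -> b <= 2^-1 ->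
  0 < t <= pi -> 0 <= sin (b * t) <= sin (t / 2).
Proof.
move=> b0 b12 /andP[t0 tpi]; have p0 := @pi_gt0 R.
have bt0 : 0 <= b * t by rewrite mulr_ge0// ltW.
have bt : b * t <= t / 2 by rewrite [t / 2]mulrC ler_pM2r.
apply/andP; split.
  by apply: sin_ge0_pi; rewrite bt0; lra.
rewrite leNgt ltr_sin ?in_itv/= -?leNgt//; apply/andP; split; lra.
Qed.

(** As [t / 2 = b t + c t], the function is [2 / (cot (b t) + cot (c t))], whose
    derivative has this form. If [b, c >= 0] and [0 < t <= pi], it lies between [0]
    and [1], since both sines are then at most [sin (t / 2)]. *)
Lemma is_derive_kernel (R : realType) (b c t : R) : b + c = 2^-1 ->
  sin (t / 2) != 0 ->
  is_derive t 1 (fun s => 2 * (sin (b * s) * sin (c * s)) * (sin (s / 2))^-1)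
    (2 * (b * sin (c * t) ^+ 2 + c * sin (b * t) ^+ 2) / sin (t / 2) ^+ 2).
Proof.
move=> bc s0.
have dS : is_derive t 1 (fun s : R => sin (s / 2)) (2^-1 * cos (t / 2)).
  have := is_derive_sinM 2^-1 t; rewrite [_^-1 * t]mulrC.
  by congr is_derive; apply/funext => s; rewrite mulrC.
have dn := is_derive_mul (is_derive_sinM b t) (is_derive_sinM c t).
have d := is_derive_mul (is_derive_mul (is_derive_const 2 t) dn)
  (is_derive_inv s0 dS).
apply: (is_derive_eq d).
have Et : t / 2 = b * t + c * t by rewrite -mulrDl bc mulrC.
have Sb := cos2Dsin2 (b * t); have Sc := cos2Dsin2 (c * t).
have -> : cos (t / 2) = cos (b * t) * cos (c * t) - sin (b * t) * sin (c * t).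
  by rewrite Et cosD.
have ES : sin (t / 2) = sin (b * t) * cos (c * t) + cos (b * t) * sin (c * t).
  by rewrite Et sinD.
move: s0; rewrite ES.
move: (sin (b * t)) (cos (b * t)) (sin (c * t)) (cos (c * t)) Sb Sc.
move=> sb cb sc cc Sb Sc s0.
rewrite -bc.
have -> : b * sc ^+ 2 + c * sb ^+ 2 =
    b * sc ^+ 2 * (cb ^+ 2 + sb ^+ 2) + c * sb ^+ 2 * (cc ^+ 2 + sc ^+ 2).
  by rewrite Sb Sc !mulr1.
by field.
Qed.

(** By [cos_sumE], [sinc_sum a - sinc_sum 0] has derivative [g t * sin (M t)]
    with [M = N + 1] and [g] as in [is_derive_kernel] for [b = (1 - a) / 2] and
    [c = a / 2]. Integrating by parts once, i.e. adding [g t * cos (M t) / M],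
    leaves the derivative [g' t * cos (M t) / M], at least [- 1 / M]. Hence the
    function [K] below, which has [t / M] added, is increasing. *)
Lemma cosecant_partial_sum (R : realType) (a : R) (N : nat) : 0 < a < 1 ->
  pi - (pi + 2) / N.+1%:R <= sin (pi * a) *
    \sum_(n < N.+1) (-1) ^+ n * ((n%:R + a)^-1 + (n%:R + 1 - a)^-1).
Proof.
move=> a01; rewrite -sinc_sum_pi//; have /andP[a0 a1] := a01.
have p0 := @pi_gt0 R.
pose b := (1 - a) / 2; pose c := a / 2.
have bc : b + c = 2^-1 by rewrite /b /c; field.
have b0 : 0 <= b by rewrite /b; lra.
have c0 : 0 <= c by rewrite /c; lra.
have b2 : b <= 2^-1 by lra.
have c2 : c <= 2^-1 by lra.
pose M : R := N.+1%:R.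
have M0 : 0 < M by rewrite /M.
have M1 : 1 <= M by rewrite /M ler1n.
pose g t := 2 * (sin (b * t) * sin (c * t)) * (sin (t / 2))^-1.
pose g' t := 2 * (b * sin (c * t) ^+ 2 + c * sin (b * t) ^+ 2) / sin (t / 2) ^+ 2.
have S0 (t : R) : 0 < t <= pi -> 0 < sin (t / 2).
  by move=> /andP[t0 tpi]; apply: sin_gt0_pi; apply/andP; split; lra.
have g'01 t : 0 < t <= pi -> 0 <= g' t <= 1.
  move=> t0; have /andP[sb0 sb1] := sinM_bounds b0 b2 t0.
  have /andP[sc0 sc1] := sinM_bounds c0 c2 t0.
  have s0 := S0 _ t0; rewrite /g'.
  have ss0 : 0 < sin (t / 2) ^+ 2 by rewrite exprn_gt0.
  have qb : sin (b * t) ^+ 2 <= sin (t / 2) ^+ 2 by rewrite ler_pXn2r// nnegrE ltW.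
  have qc : sin (c * t) ^+ 2 <= sin (t / 2) ^+ 2 by rewrite ler_pXn2r// nnegrE ltW.
  apply/andP; split.
    by rewrite divr_ge0 ?(ltW ss0)// mulr_ge0// addr_ge0// mulr_ge0// sqr_ge0.
  rewrite ler_pdivrMr// mul1r.
  have := ler_wpM2l b0 qc; have := ler_wpM2l c0 qb => H1 H2.
  have E : b * sin (t / 2) ^+ 2 + c * sin (t / 2) ^+ 2 = 2^-1 * sin (t / 2) ^+ 2.
    by rewrite -mulrDl bc.
  lra.
have g0t t : 0 < t <= pi -> 0 <= g t <= t.
  move=> t0; have /andP[sb0 sb1] := sinM_bounds b0 b2 t0.
  have /andP[sc0 sc1] := sinM_bounds c0 c2 t0.
  have s0 := S0 _ t0; have tp : 0 < t by case/andP: t0.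
  rewrite /g; apply/andP; split.
    by rewrite divr_ge0 ?(ltW s0)// mulr_ge0// mulr_ge0.
  rewrite ler_pdivrMr//.
  have sct : sin (c * t) <= c * t.
    rewrite -subr_ge0.
    have := @le_of_is_derive_ge0 R (fun s => c * s - sin (c * s))
      (fun s => c - c * cos (c * s)) 0 t tp.
    rewrite mulr0 sin0 subr0; apply.
      move=> s _.
      exact: is_derive_sub (is_derive_mulr_const c s) (is_derive_sinM c s).
    by move=> s _; rewrite subr_ge0 ler_piMr// cos_le1.
  have : sin (b * t) * sin (c * t) <= sin (t / 2) * (c * t) by exact: ler_pM.
  have : sin (t / 2) * (c * t) <= sin (t / 2) * (2^-1 * t).
    by rewrite ler_pM2l// ler_pM2r.
  lra.
pose K t := sinc_sum a N.+1 t - sinc_sum 0 N.+1 t + g t * (cos (M * t) * M^-1)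
  + M^-1 * t.
pose K' t := (g' t * cos (M * t) + 1) / M.
have KP : 0 <= K pi.
  apply: (@ge0_of_is_derive_ge0 R K K' pi (4 * M + 1)) => // t.
  - move=> t0; have s0 := lt0r_neq0 (S0 _ t0).
    have dg := is_derive_kernel bc s0.
    have dc := is_derive_mul (is_derive_cosM M t) (is_derive_const M^-1 t).
    have d := is_derive_add (is_derive_add (is_derive_sub
      (is_derive_sinc_sum a N.+1 t) (is_derive_sinc_sum 0 N.+1 t))
      (is_derive_mul dg dc)) (is_derive_mulr_const M^-1 t).
    apply: (is_derive_eq d); rewrite -/(g t) -/(g' t) /K'.
    have gE : (cos_sum a N.+1 t - cos_sum 0 N.+1 t) * sin (t / 2)
        = g t * sin (M * t) * sin (t / 2).
      rewrite mulrBl !cos_sumE -mulrBl [RHS]mulrAC; congr (_ * _).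
      rewrite /g divfK// sub0r mulNr cosN.
      have -> : (a - 2^-1) * t = - (b * t - c * t) by rewrite /b /c; field.
      have -> : 2^-1 * t = b * t + c * t by rewrite -bc mulrDl.
      by rewrite cosN cosB cosD; ring.
    have /(mulIf s0) {}gE := gE.
    rewrite gE; field; exact: lt0r_neq0.
  - move=> /andP[t0 tpi]; have tp : 0 < t <= pi by rewrite t0 ltW.
    rewrite /K' divr_ge0 ?(ltW M0)//.
    have /andP[h0 h1] := g'01 _ tp.
    have := cos_geN1 (M * t); have := cos_le1 (M * t); nra.
  - move=> /andP[t0 tpi]; have tp : 0 < t <= pi by rewrite t0 ltW.
    have /andP[h0 h1] := g0t _ tp.
    have /andP[u1 _] := sinc_sum_le a N.+1 t0.
    have /andP[_ v2] := sinc_sum_le 0 N.+1 t0.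
    rewrite -/M in u1 v2.
    have Mi : 0 < M^-1 by rewrite invr_gt0.
    have Mi1 : M^-1 <= 1 by rewrite invf_le1.
    have C1 : 0 <= cos (M * t) + 1 by have := cos_geN1 (M * t); lra.
    have C2 : 0 <= cos (M * t) * M^-1 + 1.
      have := mulr_ge0 C1 (ltW Mi); rewrite mulrDl mul1r => /le_trans; apply.
      by rewrite lerD2l.
    have C3 := mulr_ge0 h0 C2; have C4 := mulr_ge0 (ltW Mi) (ltW t0).
    rewrite mulrDr mulr1 in C3; rewrite /K; move: C3 C4 h1 u1 v2.
    set x1 := g t * _; set x2 := M^-1 * t; set x3 := g t.
    set x4 := sinc_sum a _ _; set x5 := sinc_sum 0 _ _.
    clearbody x1 x2 x3 x4 x5; lra.
have gpi : g pi * cos (M * pi) <= 2.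
  rewrite /g sin_pihalf invr1 mulr1.
  have pp : 0 < (pi : R) <= pi by rewrite p0 lexx.
  have /andP[sb0 _] := sinM_bounds b0 b2 pp.
  have /andP[sc0 _] := sinM_bounds c0 c2 pp.
  have P1 := mulr_ile1 sb0 sc0 (sin_le1 _) (sin_le1 _).
  have P0 := mulr_ge0 sb0 sc0.
  apply: le_trans (_ : 2 * (sin (b * pi) * sin (c * pi)) <= 2); last by lra.
  by rewrite ler_piMr ?cos_le1// mulr_ge0.
have : g pi * (cos (M * pi) * M^-1) <= 2 / M.
  by rewrite mulrA ler_pM2r// invr_gt0.
move: KP; rewrite /K sinc_sum0_pi -/M [(pi + 2) / M]mulrDl [M^-1 * pi]mulrC.
set x1 := g pi * _; set x2 := pi / M; set x3 := 2 / M; set x4 := sinc_sum a _ _.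
clearbody x1 x2 x3 x4; lra.
Qed.

(** * The value y belongs to every domain *)

(** The remainder after an even number of terms, [s ^ (2 k) / (1 + s)], is
    nonnegative. *)
Lemma alternating_geometric_le (R : realType) (s : R) (k : nat) : 0 <= s ->
  \sum_(n < k.*2) (-1) ^+ n * s ^+ n <= (1 + s)^-1.
Proof.
move=> s0; have s1 : 0 < 1 + s by rewrite ltr_wpDr.
rewrite -[leRHS]mul1r ler_pdivlMr// mulrC.
under eq_bigr do rewrite -exprMn mulN1r.
have -> : 1 + s = - (- s - 1) by rewrite opprB opprK.
rewrite mulNr -subrX1 opprB gerBl -mul2n exprM sqrrN exprn_ge0//.
exact: sqr_ge0.
Qed.

Lemma is_derive_powR_div (R : realType) (r x : R) : r != 0 -> 0 < x ->
  is_derive x 1 (fun t => t `^ r / r) (x `^ (r - 1)).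
Proof.
move=> r0 x0.
have := is_derive_mul (is_derive1_powR r x0) (is_derive_const r^-1 x).
by rewrite mulr0 addr0 mulrAC divff// mul1r.
Qed.

Definition alt_powR_sum (R : realType) (r : nat -> R) (N : nat) (t : R) : R :=
  \sum_(n < N) (-1) ^+ n * (t `^ r n / r n).

Lemma is_derive_alt_powR_sum (R : realType) (r : nat -> R) (N : nat) (x : R) :
  (forall n, r n != 0) -> 0 < x ->
  is_derive x 1 (alt_powR_sum r N) (\sum_(n < N) (-1) ^+ n * x `^ (r n - 1)).
Proof.
move=> r0 x0; apply: (@is_derive_sum_nat R
  (fun n t => (-1) ^+ n * (t `^ r n / r n))
  (fun n => (-1) ^+ n * x `^ (r n - 1))) => n.
have := is_derive_mul (is_derive_const ((-1) ^+ n) x)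
  (is_derive_powR_div (r0 n) x0).
by rewrite mul0r add0r.
Qed.

Lemma powR_natM (R : realType) (x q : R) (n : nat) :
  x `^ (n%:R * q) = (x `^ q) ^+ n.
Proof. by rewrite mulrC powRrM powR_mulrn// powR_ge0. Qed.

(** Term by term integration from [0] to [1] of the geometric expansion of
    [1 / (1 + t^q)] in [t^q]. *)
Lemma arcsinh1q_ge_near (R : realType) (q : R) (k : nat) : 1 < q ->
  \sum_(n < k.*2) (-1) ^+ n / (n%:R * q + 1) <= arcsinhpq 1 q 1.
Proof.
move=> q1; pose r n : R := n%:R * q + 1.
have q0 : 0 < q by exact: lt_trans q1.
have r1 n : 1 <= r n by rewrite /r lerDr mulr_ge0// ltW.
have r0 n : 0 < r n by exact: lt_le_trans (r1 n).
have -> : \sum_(n < k.*2) (-1) ^+ n / (n%:R * q + 1) = alt_powR_sum r k.*2 1.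
  by apply: eq_bigr => n _; rewrite powR1 mul1r.
rewrite -subr_ge0.
apply: (@ge0_of_is_derive_ge0 R
  (fun t => arcsinhpq 1 q t - alt_powR_sum r k.*2 t)
  (fun t => density 1 q t - \sum_(n < k.*2) (-1) ^+ n * t `^ (r n - 1))
  1 (k.*2)%:R) => // x.
- move=> /andP[x0 _]; apply: is_derive_sub; first exact: is_derive_arcsinhpq.
  by apply: is_derive_alt_powR_sum => // n; rewrite gt_eqF.
- move=> _; rewrite subr_ge0 density_1.
  under eq_bigr do rewrite addrK powR_natM.
  by apply: alternating_geometric_le; exact: powR_ge0.
- move=> /andP[x0 x1].
  have A0 : 0 <= arcsinhpq 1 q x.
    by rewrite -[leLHS](arcsinhpq0 1 q) ltW// arcsinhpq_lt.
  rewrite -[leLHS]add0r lerD// lerN2.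
  rewrite -[k.*2 in leRHS]card_ord -sumr_const mulr_suml; apply: ler_sum => n _.
  rewrite mul1r (le_trans (ler_norm _))// normrM normrX normrN1 expr1n mul1r.
  rewrite ger0_norm ?divr_ge0 ?powR_ge0 ?(ltW (r0 n))//.
  rewrite ler_pdivrMr// (@le_trans _ _ x)//.
    by apply: ge1r_powR => //; rewrite x0 ltW.
  by rewrite ler_peMr// ltW.
Qed.

(** Term by term integration from [1] to [X] of the expansion in [t^-q]; the
    subtracted term bounds the contributions of the upper end [X]. *)
Lemma arcsinh1q_ge_far (R : realType) (q X : R) (k : nat) : 1 < q -> 1 < X ->
  arcsinhpq 1 q 1 + \sum_(n < k.*2) (-1) ^+ n / (n.+1%:R * q - 1)
    - (k.*2)%:R * (X `^ (1 - q) / (q - 1)) <= arcsinhpq 1 q X.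
Proof.
move=> q1 X1; pose r n : R := 1 - n.+1%:R * q.
have q0 : 0 < q by exact: lt_trans q1.
have rq n : q - 1 <= - r n.
  by rewrite /r opprB lerD2r ler_peMl// ?ler1n// ltW.
have r0 n : r n < 0.
  by rewrite -oppr_gt0 (lt_le_trans _ (rq n))// subr_gt0.
have X0 : 0 < X by exact: lt_trans X1.
have : arcsinhpq 1 q 1 - alt_powR_sum r k.*2 1
    <= arcsinhpq 1 q X - alt_powR_sum r k.*2 X.
  apply: (@le_of_is_derive_ge0 R
    (fun t => arcsinhpq 1 q t - alt_powR_sum r k.*2 t)
    (fun t => density 1 q t - \sum_(n < k.*2) (-1) ^+ n * t `^ (r n - 1))
    1 X) => // x.
  - move=> /andP[x1 _]; have x0 : 0 < x by exact: lt_le_trans x1.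
    apply: is_derive_sub; first exact: is_derive_arcsinhpq.
    by apply: is_derive_alt_powR_sum => // n; rewrite lt_eqF.
  - move=> /andP[x1 _]; have x0 : 0 < x by exact: lt_trans x1.
    rewrite subr_ge0 density_1.
    have xq0 : 0 < x `^ q by rewrite powR_gt0.
    have E (n : nat) : x `^ (r n - 1) = x `^ (- q) * (x `^ (- q)) ^+ n.
      rewrite -exprS -powR_natM; congr (_ `^ _); rewrite /r; ring.
    under eq_bigr do rewrite E mulrCA.
    rewrite -mulr_sumr.
    have -> : (1 + x `^ q)^-1 = x `^ (- q) * (1 + x `^ (- q))^-1.
      rewrite powRN -invfM mulrDr mulr1 divff ?gt_eqF//.
      by rewrite addrC.
    rewrite ler_pM2l ?powR_gt0//.
    by apply: alternating_geometric_le; exact: powR_ge0.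
have -> : \sum_(n < k.*2) (-1) ^+ n / (n.+1%:R * q - 1) = - alt_powR_sum r k.*2 1.
  rewrite /alt_powR_sum -sumrN; apply: eq_bigr => n _.
  by rewrite powR1 mul1r -mulrN -invrN /r opprB.
have : - alt_powR_sum r k.*2 X <= (k.*2)%:R * (X `^ (1 - q) / (q - 1)).
  rewrite -[k.*2 in leRHS]card_ord -sumr_const mulr_suml -sumrN.
  apply: ler_sum => n _; rewrite mul1r (le_trans (ler_norm _))//.
  rewrite normrN normrM normrX normrN1 expr1n mul1r normrM normfV.
  rewrite ger0_norm ?powR_ge0// ltr0_norm//.
  rewrite ler_pM ?powR_ge0// ?invr_ge0 ?oppr_ge0 ?(ltW (r0 n))//.
    by apply: ler_powR; [exact: ltW|rewrite /r lerD2l lerN2 ler_peMl// ?ler1n// ltW].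
  by rewrite lef_pV2// posrE ?oppr_gt0// subr_gt0.
lra.
Qed.

Lemma powR_small (R : realType) (r e : R) : r < 0 -> 0 < e ->
  exists2 X : R, 1 < X & X `^ r <= e.
Proof.
move=> r0 e0; pose z := (1 + `|ln e|) / - r.
have z0 : 0 < z by rewrite divr_gt0 ?oppr_gt0// ltr_wpDr.
exists (expR z); first by rewrite expR_gt1.
rewrite -expRM -[leRHS]lnK ?posrE// ler_expR.
have -> : z * r = - (1 + `|ln e|) by rewrite /z; field; rewrite lt_eqF.
have := ler_norm (- ln e); rewrite normrN; lra.
Qed.

(** Choose the number [N] of terms first, making the cosecant error at most
    [d / 2], and then [X] so large that the [N] boundary terms are. *)
Lemma arcsinh1q_gt (R : realType) (q d : R) : 1 < q -> 0 < d ->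
  exists2 X : R, 1 < X & piq q / 2 - d < arcsinhpq 1 q X.
Proof.
move=> q1 d0; have q0 : 0 < q by exact: lt_trans q1.
have p0 := @pi_gt0 R.
have a0 : 0 < q^-1 by rewrite invr_gt0.
have a1 : q^-1 < 1 by rewrite invf_lt1.
pose S := q * sin (pi / q).
have S0 : 0 < S.
  by rewrite mulr_gt0// sin_gt0_pi// divr_gt0//= ltr_pdivrMr// ltr_pMr.
have piqE : piq q / 2 = pi / S by rewrite /piq -/S mulrAC [2 * pi]mulrC mulfK.
(* [N] is even, as the geometric lower bound requires, and exceeds [2 C / d]. *)
pose C := (pi + 2) / S.
have C0 : 0 < C by rewrite divr_gt0// addr_gt0.
pose k := Num.truncn (C / (d / 2)).
pose N : nat := k.+1.*2.
have N0 : 0 < N%:R :> R by rewrite ltr0n.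
have CN : C / N%:R < d / 2.
  rewrite ltr_pdivrMr// mulrC -ltr_pdivrMr ?divr_gt0//.
  rewrite (lt_le_trans (truncnS_gt _))// ler_nat -/k /N -addnn leq_addr//.
have e0 : 0 < d / 2 / N%:R * (q - 1) by rewrite mulr_gt0 ?divr_gt0// subr_gt0.
have r0 : 1 - q < 0 by rewrite subr_lt0.
have [X X1 Xe] := powR_small r0 e0.
exists X => //.
have H1 := arcsinh1q_ge_near k.+1 q1.
have H2 := arcsinh1q_ge_far k.+1 q1 X1.
(* [k.+1.*2] is convertible to [k.*2.+2]. *)
have H3 := cosecant_partial_sum k.*2.+1 (a := q^-1).
rewrite a0 a1 in H3; move/(_ isT): H3.
rewrite -[k.*2.+2]/N; rewrite -/N in H1 H2.
set T := \sum_(n < N) _ => H3.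
have ET : T = q * (\sum_(n < N) (-1) ^+ n / (n%:R * q + 1)
    + \sum_(n < N) (-1) ^+ n / (n.+1%:R * q - 1)).
  rewrite -big_split/= mulr_sumr; apply: eq_bigr => n _.
  have n0 : 0 <= n%:R :> R by [].
  have n1 : 0 < n%:R * q + 1 by rewrite ltr_wpDl// mulr_ge0// ltW.
  have n2 : 0 < (n%:R + 1) * q - 1.
    by rewrite mulrDl mul1r -addrA ltr_wpDl ?mulr_ge0 ?subr_gt0// ltW.
  rewrite -natr1; field.
  by rewrite !gt_eqF.
have H4 : pi / S - C / N%:R <= \sum_(n < N) (-1) ^+ n / (n%:R * q + 1)
    + \sum_(n < N) (-1) ^+ n / (n.+1%:R * q - 1).
  have -> : pi / S - C / N%:R = (pi - (pi + 2) / N%:R) / S.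
    by rewrite /C mulrBl; congr (_ - _); rewrite mulrAC.
  rewrite ler_pdivrMr// (le_trans H3)// ET /S.
  by rewrite [leRHS]mulrC mulrA [sin _ * q]mulrC.
have H5 : N%:R * (X `^ (1 - q) / (q - 1)) <= d / 2.
  by rewrite mulrC -ler_pdivlMr// ler_pdivrMr ?subr_gt0//.
rewrite piqE.
move: H1 H2 H4 H5 CN.
set x1 := \sum_(n < N) _; set x2 := \sum_(n < N) _.
set x3 := _ * (_ / _); set x4 := C / _; set x5 := pi / S.
clearbody x1 x2 x3 x4 x5; lra.
Qed.

(** [A_p - A_1] is increasing, so that its value at [1] is a gain independent of
    [X] over the bound for [A_1], enough to pass from approximation of [pi_q / 2]
    to a strict inequality. *)
Lemma arcsinhpq_gt_piq (R : realType) (p q : R) : 1 < p -> 1 < q ->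
  exists2 X : R, 0 < X & piq q / 2 < arcsinhpq p q X.
Proof.
move=> p1 q1; have p0 : 0 < p by exact: lt_trans p1.
pose D t := arcsinhpq p q t - arcsinhpq 1 q t.
have dD (t : R) : 0 < t -> is_derive t 1 D (density p q t - density 1 q t).
  by move=> t0; apply: is_derive_sub; exact: is_derive_arcsinhpq.
have D1 : 0 < D 1.
  apply: (@le_lt_trans _ _ (D 2^-1)).
    by rewrite /D subr_ge0 arcsinhpq_le_p// ltW.
  apply: (lt_of_is_derive_gt0 (f' := fun t => density p q t - density 1 q t)).
  - by rewrite invf_lt1// ltr1n.
  - by move=> t /andP[t0 _]; apply: dD; rewrite (lt_le_trans _ t0).
  - move=> t /andP[t0 _]; rewrite subr_gt0 lt_density//.
    by rewrite (lt_trans _ t0).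
have [X X1 HX] := arcsinh1q_gt q1 D1.
exists X; first exact: lt_trans X1.
have : D 1 <= D X.
  apply: (le_of_is_derive_ge0 (f' := fun t => density p q t - density 1 q t)) => //.
  - by move=> t /andP[t0 _]; apply: dD; rewrite (lt_le_trans _ t0).
  - by move=> t _; rewrite subr_ge0 le_density// ltW.
rewrite [D X]/D; lra.
Qed.

Lemma ln_sinhpq_convex (R : realType) (l m p1 p2 q y : R) :
  0 <= l -> 0 <= m -> l + m = 1 -> 1 < p1 -> p1 <= p2 -> 1 < q ->
  0 < y -> y <= piq q / 2 ->
  ln (sinhpq (l * p1 + m * p2) q y)
    <= l * ln (sinhpq p1 q y) + m * ln (sinhpq p2 q y).
Proof.
move=> l0 m0 lm p11 p12 q1 y0 yq.
have p21 : 1 < p2 by exact: lt_le_trans p12.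
have p1' : 1 < l * p1 + m * p2.
  by have : p1 <= l * p1 + m * p2; [nra|exact: lt_le_trans].
have [b1 b10 yb1] := arcsinhpq_gt_piq p11 q1.
have [b2 b20 yb2] := arcsinhpq_gt_piq p21 q1.
have [b b0 yb] := arcsinhpq_gt_piq p1' q1.
have {}yb1 := le_trans yq (ltW yb1).
have {}yb2 := le_trans yq (ltW yb2).
have {}yb := le_trans yq (ltW yb).
have gt0 (p : R) : 1 < p -> 0 < p by exact: lt_trans.
have := le_arcsinhpq_geo l0 m0 lm (gt0 _ p11) p12 (gt0 _ q1) y0
  (ltW b10) (ltW b20) yb1 yb2.
have [|x0 Ex] := sinhpq_spec (gt0 _ p1') (ltW b0) (s := y) (q := q).
  by rewrite y0.
set X := expR _ => yX.
rewrite -[leRHS]expRK -/X ler_ln ?posrE ?expR_gt0//.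
rewrite leNgt; apply/negP => Xx.
have := arcsinhpq_lt q (gt0 _ p1') (ltW (expR_gt0 _)) Xx.
by rewrite Ex => /(le_lt_trans yX); rewrite ltxx.
Qed.

Theorem theorem4 (R : realType) (q : R) (hq : 1 < q)
  (y : R) (hy0 : 0 < y) (hy : y <= piq q / 2) :
  log_convex `]1, +oo[ (fun p : R => sinhpq p q y).
Proof.
split=> [p|t p1 p2].
  rewrite /= in_itv/= andbT => p1.
  have [b b0 yb] := arcsinhpq_gt_piq p1 hq.
  have [|//] := sinhpq_spec (lt_trans ltr01 p1) (ltW b0) (s := y) (q := q).
  by rewrite hy0 (le_trans hy)// ltW.
rewrite !inE/= !in_itv/= !andbT => hp1 hp2.
have t0 : 0 <= t%:num by [].
have u0 : 0 <= 1 - t%:num by rewrite subr_ge0.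
have [p12|/ltW p21] := leP p1 p2.
  apply: (ln_sinhpq_convex t0 u0) => //.
  by rewrite addrC subrK.
have := ln_sinhpq_convex u0 t0 (subrK _ _) hp2 p21 hq hy0 hy.
by rewrite ![(1 - _) * _ + _]addrC.
Qed.
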